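(* Suppose that the common ($n$-th) term of the sequence of equations generated from $y_0''+a_0y_0=0$ by the Euler–Imshenetsky–Darboux transformation has the form $$y_n''+\left[a_0+n(n+1)\left(\frac{\tilde y_0'}{\tilde y_0}\right)'\right]y_n=0,\qquad \frac{\tilde y_0'}{\tilde y_0}=\alpha_0 .$$ Then its solution (general or partial) can be represented in the form $$y_n=\prod_{k=n}^{1}\left(D-k\frac{\tilde y_0'}{\tilde y_0}\right)y_0=\tilde y_0^{\,n}\left(D\frac1{\tilde y_0}\right)^{n}y_0,$$ or $$y_n=\prod_{k=n}^{0}\left(D-k\frac{\tilde y_0'}{\tilde y_0}\right)D^{-1}y_0=\tilde y_0^{\,n+1}\left(\tilde y_0^{-1}D\right)^{n+1}D^{-1}y_0,$$ where $y_0$ is the general or a partial solution of the equation $y''+a_0y=0$, and $\tilde y_0$ is a partial solution of the equation $y''+(a_0-\lambda)y=0$ corresponding to the eigenvalue $\lambda=\lambda_0$.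
   Context: $a_0=a_0(x)$ is a continuous function on an interval $I$, $D=d/dx$, and $n\ge 1$ is an integer. Quotients are considered where their denominators do not vanish. A product $\prod_{k=n}^{1}L_k$ of operators denotes the composition $L_nL_{n-1}\cdots L_1$ ($L_1$ is applied first), and similarly $\prod_{k=n}^{0}L_k=L_n\cdots L_1L_0$. Functions act by multiplication: $D\frac1f$ sends $y$ to $(y/f)'$ and $f^{-1}D$ sends $y$ to $y'/f$. $D^{-1}y_0$ denotes an antiderivative of $y_0$. ''Partial solution'' means a particular solution. The Euler–Imshenetsky–Darboux sequence generated by $y_0''+a_0y_0=0$ is obtained as follows. For $s\ge1$, given $y_{s-1}''+a_{s-1}y_{s-1}=0$, let $\tilde y_{s-1}$ be an eigenfunction corresponding to the eigenvalue $\lambda=\lambda_{s-1}$, i.e. a solution of $\tilde y_{s-1}''+(a_{s-1}-\lambda_{s-1})\tilde y_{s-1}=0$. The transformation $y_s=y_{s-1}'-\frac{\tilde y_{s-1}'}{\tilde y_{s-1}}y_{s-1}$ then leads to the next equation $y_s''+a_sy_s=0$ with $a_s=a_{s-1}+2\left(\tilde y_{s-1}'/\tilde y_{s-1}\right)'$. Thus the $n$-th equation is $y_n''+a_ny_n=0$ with $a_n=a_0+2\sum_{s=1}^{n}\left(\tilde y_{s-1}'/\tilde y_{s-1}\right)'$.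
   Formalization: Added: at some point ỹ_s'/ỹ_s=(s+1)ỹ_0'/ỹ_0 for each s<n (no integration constant; for n≥2 this forces a_0 constant, and the formula fails otherwise); and, for the claim that the general solution is represented, all λ_s≠0, s<n. *)

(* Defs.v *)
(* Stdlib reals with Coquelicot. *)
From Stdlib Require Import Reals Lra Lia.
From Coquelicot Require Import Coquelicot.
Open Scope R_scope.

Definition is_interval (I : R -> Prop) : Prop :=
  forall x y z : R, I x -> I y -> x <= z <= y -> I z.

(* [y'' + a y = 0] on [J].  [Derive] is total, so differentiability of [y]
   and of [y'] is required explicitly. *)
Definition solves (J : R -> Prop) (a y : R -> R) : Prop :=
  forall x, J x ->
    ex_derive y x /\ ex_derive (Derive y) x /\
    Derive (Derive y) x + a x * y x = 0.

Definition logder (f : R -> R) : R -> R := fun x => Derive f x / f x.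

Definition antiderivative_on (J : R -> Prop) (f F : R -> R) : Prop :=
  forall x, J x -> is_derive F x (f x).

Definition operator : Type := (R -> R) -> (R -> R).

Definition D_minus (b : R -> R) : operator :=
  fun y x => Derive y x - b x * y x.

(* D (1/f) : y |-> (y/f)' *)
Definition D_inv (f : R -> R) : operator :=
  fun y => Derive (fun x => y x / f x).

(* f^{-1} D : y |-> y'/f *)
Definition inv_D (f : R -> R) : operator :=
  fun y x => Derive y x / f x.

(* [opprod L m len] is the composition L_{m+len-1} ... L_{m+1} L_m of [len]
   operators, L_m being applied first. *)
Fixpoint opprod (L : nat -> operator) (m len : nat) (y : R -> R) : R -> R :=
  match len with
  | O => y
  | S l => L (m + l)%nat (opprod L m l y)
  end.

Definition oppow (L : operator) (len : nat) : operator :=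
  opprod (fun _ => L) 0 len.

(* Every function to which one of the [len] factors is applied is
   differentiable on [J], so that no [Derive] below takes a default value.
   For the factor D (1/f), with f differentiable and without zeros, this is
   the same as differentiability of the quotient by f. *)
Definition defined_on (J : R -> Prop) (L : nat -> operator) (m len : nat)
    (y : R -> R) : Prop :=
  forall l, (l < len)%nat -> forall x, J x -> ex_derive (opprod L m l y) x.

(* The first [n] steps of an Euler-Imshenetsky-Darboux sequence on [J]:
   [a s] is the potential of the s-th equation, [yt s] the eigenfunction
   for the eigenvalue [lam s] that generates the step from s to s+1. *)
Record EID_sequence (J : R -> Prop) (n : nat) (a yt : nat -> R -> R)
    (lam : nat -> R) : Prop := {
  EID_eigenfunction : forall s, (s < n)%nat ->
    solves J (fun x => a s x - lam s) (yt s);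
  EID_nonvanishing : forall s, (s < n)%nat -> forall x, J x -> yt s x <> 0;
  EID_potential : forall s, (s < n)%nat -> forall x, J x ->
    a (S s) x = a s x + 2 * Derive (logder (yt s)) x
}.

Definition EID_transforms (J : R -> Prop) (n : nat) (yt y : nat -> R -> R)
    : Prop :=
  forall s, (s < n)%nat -> forall x, J x ->
    y (S s) x = Derive (y s) x - logder (yt s) x * y s x.

Definition nth_potential (a0 f : R -> R) (n : nat) : R -> R :=
  fun x => a0 x + INR n * (INR n + 1) * Derive (logder f) x.

(* If the s-th potential is [nth_potential (a 0) (yt 0) s] for all s <= n, then
   (yt_s'/yt_s)' = (s+1) (yt_0'/yt_0)', so on an interval yt_s'/yt_s and
   (s+1) yt_0'/yt_0 differ by a constant of integration.  This asks that the
   constant be 0, by requiring equality at one point.  The potentials alone do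
   not force it: a_0 = - 1/(e^x+1), lam_s = c_s^2 with
   c_s = s(s+2)/(2(s+1)), yt_s = (1+e^{-x})^{s+1} e^{c_s x}. *)
Definition no_integration_constant (J : R -> Prop) (n : nat)
    (yt : nat -> R -> R) : Prop :=
  forall s, (s < n)%nat -> exists x, J x /\
    logder (yt s) x = INR (S s) * logder (yt 0%nat) x.

Definition L_k (f : R -> R) (k : nat) : operator :=
  D_minus (fun x => INR k * logder f x).

Definition representation1 (J : R -> Prop) (n : nat) (f y0 yn : R -> R)
    : Prop :=
  defined_on J (L_k f) 1 n y0 /\
  defined_on J (fun _ => D_inv f) 0 n y0 /\
  forall x, J x ->
    yn x = opprod (L_k f) 1 n y0 x /\
    yn x = f x ^ n * oppow (D_inv f) n y0 x.

(* [Y0] plays the role of D^{-1} y0. *)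
Definition representation2 (J : R -> Prop) (n : nat) (f Y0 yn : R -> R)
    : Prop :=
  defined_on J (L_k f) 0 (S n) Y0 /\
  defined_on J (fun _ => inv_D f) 0 (S n) Y0 /\
  forall x, J x ->
    yn x = opprod (L_k f) 0 (S n) Y0 x /\
    yn x = f x ^ (S n) * oppow (inv_D f) (S n) Y0 x.

(* Main.v *)
Require Import Defs.
From Stdlib Require Import Reals Lra Lia.
From Coquelicot Require Import Coquelicot.
Open Scope R_scope.

(** Everything is governed by the logarithmic derivatives [b_s = yt_s' / yt_s].
    That [yt_s] is an eigenfunction for [lam_s] is the Riccati equation
    [b_s' = lam_s - a_s - b_s^2], and this alone makes the step
    [z = y' - b_s y] carry solutions of [y'' + a_s y = 0] to solutions of
    [z'' + (a_s + 2 b_s') z = 0] ([darboux_solves]).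

    The prescribed form of the potentials gives [b_s' = (s+1) b_0'] on the
    interval [J]; the constant of integration being zero, [b_s = (s+1) b_0]
    ([logder_eigenfunction]).  Hence the [s]-th step is [D - (s+1) b_0], and the
    product of the first-order operators is the sequence itself.  The powers of
    [D (1/f)] and [f^{-1} D] follow from the conjugation
    [(y / f^k)' = (y' - k (f'/f) y) / f^k] ([is_derive_div_pow]): after [l]
    factors one finds [y_l / f^l] and, starting from an antiderivative of [y_0],
    [y_{l-1} / f^l].

    That every solution of the [n]-th equation is obtained when the eigenvalues
    are nonzero comes from the inversion of a step: [-b] satisfies the Riccati
    equation of the new potential, so [w = z' + b z] is a step back, and the two
    steps compose to multiplication by [-lam] ([darboux_onto]). *)

(** * Functions known on an open set only *)

Lemma is_derive_ext_open (J : R -> Prop) (f g : R -> R) (x l : R) :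
  open J -> (forall t, J t -> f t = g t) -> J x ->
  is_derive f x l -> is_derive g x l.
Proof.
  intros hJo hfg hx hf.
  apply (is_derive_ext_loc f); [|exact hf].
  apply (filter_imp J); [exact hfg | exact (hJo x hx)].
Qed.

Lemma Derive_ext_open (J : R -> Prop) (f g : R -> R) (x : R) :
  open J -> (forall t, J t -> f t = g t) -> J x -> Derive f x = Derive g x.
Proof.
  intros hJo hfg hx.
  apply Derive_ext_loc, (filter_imp J); [exact hfg | exact (hJo x hx)].
Qed.

Lemma solves_intro (J : R -> Prop) (a y dy : R -> R) :
  open J ->
  (forall x, J x -> is_derive y x (dy x)) ->
  (forall x, J x -> is_derive dy x (- a x * y x)) ->
  solves J a y.
Proof.
  intros hJo hy hdy x hx.
  assert (hd2 : is_derive (Derive y) x (- a x * y x)).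
  { apply (is_derive_ext_open J dy); auto.
    intros t ht. symmetry. apply is_derive_unique. auto. }
  split; [exists (dy x); auto|].
  split; [exists (- a x * y x); exact hd2|].
  rewrite (is_derive_unique _ _ _ hd2). ring.
Qed.

Lemma solves_is_derive (J : R -> Prop) (a y : R -> R) (x : R) :
  solves J a y -> J x -> is_derive y x (Derive y x).
Proof. intros hy hx. apply Derive_correct, (hy x hx). Qed.

Lemma solves_is_derive2 (J : R -> Prop) (a y : R -> R) (x : R) :
  solves J a y -> J x -> is_derive (Derive y) x (- a x * y x).
Proof.
  intros hy hx. destruct (hy x hx) as (_ & h2 & h).
  replace (- a x * y x) with (Derive (Derive y) x) by lra.
  apply Derive_correct, h2.
Qed.

Lemma solves_ext (J : R -> Prop) (a a' y : R -> R) :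
  (forall x, J x -> a' x = a x) -> solves J a y -> solves J a' y.
Proof. intros ha hy x hx. rewrite (ha x hx). exact (hy x hx). Qed.

(** * Open intervals *)

Lemma eq_on_interval_of_is_derive (J : R -> Prop) (f g df : R -> R) (x0 x : R) :
  is_interval J ->
  (forall t, J t -> is_derive f t (df t)) ->
  (forall t, J t -> is_derive g t (df t)) ->
  J x0 -> f x0 = g x0 -> J x -> f x = g x.
Proof.
  intros hJ hf hg hx0 h0 hx.
  assert (hin : forall t, Rmin x0 x <= t <= Rmax x0 x -> J t).
  { intros t ht. destruct (Rle_dec x0 x) as [h|h].
    - rewrite Rmin_left, Rmax_right in ht by lra. exact (hJ x0 x t hx0 hx ht).
    - rewrite Rmin_right, Rmax_left in ht by lra. exact (hJ x x0 t hx hx0 ht). }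
  assert (hd : forall t, J t -> is_derive (fun s => f s - g s) t 0).
  { intros t ht. replace 0 with (minus (df t) (df t)) by apply Rminus_diag.
    apply @is_derive_minus; auto. }
  destruct (MVT_gen (fun t => f t - g t) x0 x (fun _ => 0)) as (c & _ & hc).
  - intros t ht. apply hd, hin. lra.
  - intros t ht. apply continuity_pt_filterlim.
    apply (@ex_derive_continuous R_AbsRing R_NormedModule (fun s => f s - g s)).
    exists 0. apply hd, hin, ht.
  - lra.
Qed.

Lemma ex_antiderivative_on (J : R -> Prop) (f : R -> R) (c : R) :
  is_interval J -> open J -> J c -> (forall x, J x -> continuous f x) ->
  exists F, antiderivative_on J f F.
Proof.
  intros hJ hJo hc hf. exists (fun x => RInt f c x). intros x hx.
  apply (is_derive_RInt f (fun x => RInt f c x) c x); [|exact (hf x hx)].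
  apply (filter_imp J); [|exact (hJo x hx)].
  intros t ht. apply (RInt_correct f), (ex_RInt_continuous f).
  intros z hz. apply hf. destruct (Rle_dec c t) as [h|h].
  - rewrite Rmin_left, Rmax_right in hz by lra. exact (hJ c t z hc ht hz).
  - rewrite Rmin_right, Rmax_left in hz by lra. exact (hJ t c z ht hc hz).
Qed.

(** * One Darboux step *)

(** The equation satisfied by the logarithmic derivative of a solution of
    [y'' + (a - lam) y = 0].  The lemmas on Darboux steps assume only this, so
    that the inverse step, whose eigenfunction would be the reciprocal of the
    original one, is an instance of them. *)
Definition riccati (J : R -> Prop) (a : R -> R) (lam : R) (b : R -> R) : Prop :=
  forall x, J x -> is_derive b x (lam - a x - b x ^ 2).

Lemma riccati_logder (J : R -> Prop) (a f : R -> R) (lam : R) :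
  solves J (fun x => a x - lam) f -> (forall x, J x -> f x <> 0) ->
  riccati J a lam (logder f).
Proof.
  intros hf hnz x hx. unfold logder.
  pose proof (hnz x hx) as h0.
  replace (lam - a x - (Derive f x / f x) ^ 2)
    with ((- (a x - lam) * f x * f x - Derive f x * Derive f x) / f x ^ 2)
    by (field; exact h0).
  apply is_derive_div; [ | | exact h0].
  - exact (solves_is_derive2 _ _ _ _ hf hx).
  - exact (solves_is_derive _ _ _ _ hf hx).
Qed.

(** By the Riccati equation the second-order terms cancel: [D + b] undoes
    [D - b] on solutions, up to the factor [- lam]. *)
Lemma darboux_is_derive (J : R -> Prop) (a b y z : R -> R) (lam x : R) :
  open J -> riccati J a lam b -> solves J a y ->
  (forall t, J t -> z t = Derive y t - b t * y t) -> J x ->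
  is_derive z x (- lam * y x - b x * z x).
Proof.
  intros hJo hb hy hz hx.
  apply (is_derive_ext_open J (fun t => Derive y t - b t * y t)); auto.
  { intros t ht. symmetry. auto. }
  rewrite (hz x hx).
  pose proof (solves_is_derive _ _ _ _ hy hx) as h1.
  pose proof (solves_is_derive2 _ _ _ _ hy hx) as h2.
  pose proof (hb x hx) as h3.
  replace (- lam * y x - b x * (Derive y x - b x * y x))
    with (minus (- a x * y x)
            (plus (mult (lam - a x - b x ^ 2) (y x)) (mult (b x) (Derive y x))))
    by (unfold minus, plus, opp, mult; simpl; unfold mult; simpl; ring).
  apply @is_derive_minus; [exact h2|].
  apply @is_derive_mult; [exact h3 | exact h1 | exact Rmult_comm].
Qed.

Lemma darboux_solves (J : R -> Prop) (a a' b y z : R -> R) (lam : R) :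
  open J -> riccati J a lam b ->
  (forall x, J x -> a' x = a x + 2 * Derive b x) ->
  solves J a y -> (forall x, J x -> z x = Derive y x - b x * y x) ->
  solves J a' z.
Proof.
  intros hJo hb ha' hy hz.
  pose proof (fun x => darboux_is_derive J a b y z lam x hJo hb hy hz) as hdz.
  apply (solves_intro J a' z (fun x => - lam * y x - b x * z x)); auto.
  intros x hx.
  rewrite (ha' x hx), (is_derive_unique _ _ _ (hb x hx)).
  pose proof (solves_is_derive _ _ _ _ hy hx) as h1.
  replace (- (a x + 2 * (lam - a x - b x ^ 2)) * z x)
    with (minus (mult (- lam) (Derive y x))
            (plus (mult (lam - a x - b x ^ 2) (z x))
               (mult (b x) (- lam * y x - b x * z x)))).
  - apply @is_derive_minus.
    + apply (is_derive_scal y x (- lam)). exact h1.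
    + apply @is_derive_mult; [exact (hb x hx) | exact (hdz x hx) | exact Rmult_comm].
  - unfold minus, plus, opp, mult; simpl; unfold mult; simpl.
    rewrite (hz x hx). ring.
Qed.

Lemma riccati_opp (J : R -> Prop) (a a' b : R -> R) (lam : R) :
  riccati J a lam b -> (forall x, J x -> a' x = a x + 2 * Derive b x) ->
  riccati J a' lam (fun x => - b x).
Proof.
  intros hb ha' x hx.
  rewrite (ha' x hx), (is_derive_unique _ _ _ (hb x hx)).
  replace (lam - (a x + 2 * (lam - a x - b x ^ 2)) - (- b x) ^ 2)
    with (opp (lam - a x - b x ^ 2)) by (unfold opp; simpl; ring).
  apply @is_derive_opp, (hb x hx).
Qed.

Lemma solves_scal (J : R -> Prop) (a y : R -> R) (c : R) :
  open J -> solves J a y -> solves J a (fun x => c * y x).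
Proof.
  intros hJo hy.
  apply (solves_intro J a _ (fun x => c * Derive y x)); auto; intros x hx.
  - apply (is_derive_scal y x c), (solves_is_derive _ _ _ _ hy hx).
  - replace (- a x * (c * y x)) with (c * (- a x * y x)) by ring.
    apply (is_derive_scal (Derive y) x c), (solves_is_derive2 _ _ _ _ hy hx).
Qed.

(** The candidate is [(z' + b z) / (- lam)]: with [- b] in place of [b] and the
    two potentials exchanged, [darboux_solves] shows that it is a solution and
    [darboux_is_derive] that the step takes it to [z]. *)
Lemma darboux_onto (J : R -> Prop) (a a' b z : R -> R) (lam : R) :
  open J -> riccati J a lam b ->
  (forall x, J x -> a' x = a x + 2 * Derive b x) ->
  lam <> 0 -> solves J a' z ->
  exists y, solves J a y /\ forall x, J x -> z x = Derive y x - b x * y x.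
Proof.
  intros hJo hb ha' hlam hz.
  pose proof (riccati_opp _ _ _ _ _ hb ha') as hb'.
  set (w := fun x => Derive z x - - b x * z x).
  assert (hw : forall x, J x -> w x = Derive z x - - b x * z x) by reflexivity.
  exists (fun x => - / lam * w x). split.
  - apply solves_scal; [exact hJo|].
    apply (darboux_solves J a' a (fun x => - b x) z w lam); auto.
    intros x hx. rewrite Derive_opp, (ha' x hx). ring.
  - intros x hx. rewrite Derive_scal.
    rewrite (is_derive_unique _ _ _
      (darboux_is_derive J a' (fun x => - b x) z w lam x hJo hb' hz hw hx)).
    field. exact hlam.
Qed.

(** * The sequence of transformations *)

Lemma EID_riccati (J : R -> Prop) (n s : nat) (a yt : nat -> R -> R)
    (lam : nat -> R) :
  EID_sequence J n a yt lam -> (s < n)%nat ->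
  riccati J (a s) (lam s) (logder (yt s)).
Proof.
  intros hseq hs. apply riccati_logder.
  - exact (EID_eigenfunction _ _ _ _ _ hseq s hs).
  - exact (EID_nonvanishing _ _ _ _ _ hseq s hs).
Qed.

Lemma EID_solves (J : R -> Prop) (n : nat) (a yt y : nat -> R -> R)
    (lam : nat -> R) :
  open J -> EID_sequence J n a yt lam -> EID_transforms J n yt y ->
  solves J (a 0%nat) (y 0%nat) ->
  forall s, (s <= n)%nat -> solves J (a s) (y s).
Proof.
  intros hJo hseq hy h0 s. induction s as [|s IH]; intros hs; [exact h0|].
  apply (darboux_solves J (a s) (a (S s)) (logder (yt s)) (y s) (y (S s)) (lam s)).
  - exact hJo.
  - apply (EID_riccati J n); [exact hseq | lia].
  - intros x hx. apply (EID_potential _ _ _ _ _ hseq); [lia | exact hx].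
  - apply IH. lia.
  - intros x hx. apply hy; [lia | exact hx].
Qed.

(** The last step is inverted first, which leaves the same problem for one step
    less. *)
Lemma EID_onto (J : R -> Prop) (n : nat) (a yt : nat -> R -> R)
    (lam : nat -> R) :
  open J -> EID_sequence J n a yt lam ->
  (forall s, (s < n)%nat -> lam s <> 0) ->
  forall s u, (s <= n)%nat -> solves J (a s) u ->
  exists y, solves J (a 0%nat) (y 0%nat) /\ EID_transforms J s yt y /\ y s = u.
Proof.
  intros hJo hseq hlam s. induction s as [|s IH]; intros u hs hu.
  { exists (fun _ => u). repeat split; [apply hu; assumption.. |].
    intros r hr. lia. }
  destruct (darboux_onto J (a s) (a (S s)) (logder (yt s)) u (lam s))
    as (v & hv & huv); auto.
  { apply (EID_riccati J n); [exact hseq | lia]. }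
  { intros x hx. apply (EID_potential _ _ _ _ _ hseq); [lia | exact hx]. }
  destruct (IH v) as (y & hy0 & hy & <-); [lia | exact hv |].
  exists (fun k => if (k <=? s)%nat then y k else u). split; [exact hy0|].
  split; [|rewrite (proj2 (Nat.leb_gt (S s) s)) by lia; reflexivity].
  intros r hr x hx. rewrite (proj2 (Nat.leb_le r s)) by lia.
  destruct (Nat.eq_dec r s) as [->|hne].
  - rewrite (proj2 (Nat.leb_gt (S s) s)) by lia. exact (huv x hx).
  - rewrite (proj2 (Nat.leb_le (S r) s)) by lia. apply hy; [lia | exact hx].
Qed.

(** The increments of the potential are [2 (s+1) b_0'] by its prescribed form
    and [2 b_s'] by the transformation, with [b_s = yt_s' / yt_s]; integrating,
    [b_s] and [(s+1) b_0] agree wherever they agree at one point. *)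
Lemma logder_eigenfunction (J : R -> Prop) (n s : nat) (a yt : nat -> R -> R)
    (lam : nat -> R) (x : R) :
  is_interval J -> EID_sequence J n a yt lam ->
  (forall s, (s <= n)%nat -> forall x, J x ->
     a s x = nth_potential (a 0%nat) (yt 0%nat) s x) ->
  no_integration_constant J n yt ->
  (s < n)%nat -> J x ->
  logder (yt s) x = INR (S s) * logder (yt 0%nat) x.
Proof.
  intros hJ hseq hform hconst hs hx.
  assert (hD : forall r, (r < n)%nat -> forall t, J t ->
            is_derive (logder (yt r)) t (Derive (logder (yt r)) t)).
  { intros r hr t ht. apply Derive_correct. eexists.
    exact (EID_riccati _ _ _ _ _ _ hseq hr t ht). }
  destruct (hconst s hs) as (x0 & hx0 & h0).
  apply (eq_on_interval_of_is_derive J (logder (yt s))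
    (fun t => INR (S s) * logder (yt 0%nat) t)
    (fun t => Derive (logder (yt s)) t) x0); auto.
  intros t ht.
  replace (Derive (logder (yt s)) t)
    with (INR (S s) * Derive (logder (yt 0%nat)) t).
  - apply (is_derive_scal (logder (yt 0%nat)) t (INR (S s))).
    apply hD; [lia | exact ht].
  - pose proof (EID_potential _ _ _ _ _ hseq s hs t ht) as h.
    rewrite (hform (S s)), (hform s) in h by (lia || exact ht).
    unfold nth_potential in h. rewrite S_INR in *. lra.
Qed.

(** * Products of first-order operators *)

Definition local_op (J : R -> Prop) (L : operator) : Prop :=
  forall g h, (forall x, J x -> g x = h x) -> forall x, J x -> L g x = L h x.

Lemma local_L_k (J : R -> Prop) (f : R -> R) (k : nat) :
  open J -> local_op J (L_k f k).
Proof.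
  intros hJo g h hgh x hx. unfold L_k, D_minus.
  rewrite (Derive_ext_open J g h x hJo hgh hx), (hgh x hx). reflexivity.
Qed.

Lemma local_D_inv (J : R -> Prop) (f : R -> R) : open J -> local_op J (D_inv f).
Proof.
  intros hJo g h hgh x hx. apply (Derive_ext_open J); auto.
  intros t ht. rewrite (hgh t ht). reflexivity.
Qed.

Lemma local_inv_D (J : R -> Prop) (f : R -> R) : open J -> local_op J (inv_D f).
Proof.
  intros hJo g h hgh x hx. unfold inv_D.
  rewrite (Derive_ext_open J g h x hJo hgh hx). reflexivity.
Qed.

(** Computes an operator product from a guess [w] of its partial products; the
    operators being local, it is enough to check the guess on [J]. *)
Lemma opprod_eq (J : R -> Prop) (L : nat -> operator) (m len : nat)
    (w : nat -> R -> R) (y : R -> R) :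
  (forall k, local_op J (L k)) ->
  (forall x, J x -> y x = w 0%nat x) ->
  (forall l, (l < len)%nat -> forall x, J x -> L (m + l)%nat (w l) x = w (S l) x) ->
  forall l, (l <= len)%nat -> forall x, J x -> opprod L m l y x = w l x.
Proof.
  intros hL h0 hw l. induction l as [|l IH]; intros hl x hx; [exact (h0 x hx)|].
  simpl. rewrite <- (hw l hl x hx). apply hL; [|exact hx].
  apply IH. lia.
Qed.

Lemma opprod_defined (J : R -> Prop) (L : nat -> operator) (m len : nat)
    (w : nat -> R -> R) (y : R -> R) :
  open J ->
  (forall l, (l < len)%nat -> forall x, J x -> opprod L m l y x = w l x) ->
  (forall l, (l < len)%nat -> forall x, J x -> ex_derive (w l) x) ->
  defined_on J L m len y.
Proof.
  intros hJo hw hd l hl x hx. destruct (hd l hl x hx) as (d & h).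
  exists d. apply (is_derive_ext_open J (w l)); auto.
  intros t ht. symmetry. auto.
Qed.

(** Conjugation by [f^k] turns [D] into [D - k f'/f]; it is the link between the
    products of distinct factors and the powers of a single one. *)
Lemma is_derive_div_pow (f y : R -> R) (k : nat) (x : R) :
  ex_derive f x -> ex_derive y x -> f x <> 0 ->
  is_derive (fun t => y t / f t ^ k) x (L_k f k y x / f x ^ k).
Proof.
  intros hf hy h0. unfold L_k, D_minus, logder.
  auto_derive.
  - repeat split; auto. apply pow_nonzero, h0.
  - change (fun t => y t) with y. change (fun t => f t) with f.
    destruct k as [|k]; [simpl; field; exact h0|].
    rewrite <- tech_pow_Rmult, Nat.pred_succ. field.
    split; [exact h0 | apply pow_nonzero, h0].
Qed.

(** Division of the [l]-th function by [f^l] turns the step [D - (l+1) f'/f]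
    into [D (1/f)], whatever [l]. *)
Lemma representation1_of_steps (J : R -> Prop) (n : nat) (f : R -> R)
    (y : nat -> R -> R) :
  open J ->
  (forall x, J x -> ex_derive f x) -> (forall x, J x -> f x <> 0) ->
  (forall l, (l <= n)%nat -> forall x, J x -> ex_derive (y l) x) ->
  (forall l, (l < n)%nat -> forall x, J x -> L_k f (S l) (y l) x = y (S l) x) ->
  representation1 J n f (y 0%nat) (y n).
Proof.
  intros hJo hf h0 hy hstep.
  assert (e1 : forall l, (l <= n)%nat -> forall x, J x ->
            opprod (L_k f) 1 l (y 0%nat) x = y l x).
  { apply opprod_eq; auto. intros k. apply local_L_k, hJo. }
  assert (e2 : forall l, (l <= n)%nat -> forall x, J x ->
            opprod (fun _ => D_inv f) 0 l (y 0%nat) x = y l x / f x ^ l).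
  { apply (opprod_eq J (fun _ => D_inv f) 0 n (fun l x => y l x / f x ^ l)).
    - intros k. apply local_D_inv, hJo.
    - intros x hx. simpl. field.
    - intros l hl x hx. rewrite <- (hstep l hl x hx). unfold D_inv.
      rewrite (Derive_ext_open J _ (fun t => y l t / f t ^ S l)); auto.
      + apply is_derive_unique, is_derive_div_pow; auto. apply hy; [lia|exact hx].
      + intros t ht. simpl. field. split; [apply pow_nonzero|]; auto. }
  split; [|split].
  - apply (opprod_defined J _ _ _ y); auto; intros l hl; [apply e1|apply hy]; lia.
  - apply (opprod_defined J _ _ _ (fun l x => y l x / f x ^ l)); auto.
    + intros l hl. apply e2. lia.
    + intros l hl x hx. eexists. apply is_derive_div_pow; auto.
      apply hy; [lia|exact hx].
  - intros x hx. unfold oppow. rewrite e1, e2 by (lia || exact hx).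
    split; [reflexivity|]. field. apply pow_nonzero. auto.
Qed.

(** The factor with [k = 0] is [D], so an antiderivative of [y_0] is one more
    term in front of the sequence.  After this shift of the index the step is
    [D - l f'/f], which division by [f^l] turns into [f^{-1} D]. *)
Lemma representation2_of_steps (J : R -> Prop) (n : nat) (f Y0 : R -> R)
    (y : nat -> R -> R) :
  open J ->
  (forall x, J x -> ex_derive f x) -> (forall x, J x -> f x <> 0) ->
  (forall l, (l <= n)%nat -> forall x, J x -> ex_derive (y l) x) ->
  (forall l, (l < n)%nat -> forall x, J x -> L_k f (S l) (y l) x = y (S l) x) ->
  antiderivative_on J (y 0%nat) Y0 ->
  representation2 J n f Y0 (y n).
Proof.
  intros hJo hf h0 hy hstep hY0.
  set (w := fun l => match l with O => Y0 | S l => y l end).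
  assert (hw : forall l, (l <= S n)%nat -> forall x, J x -> ex_derive (w l) x).
  { intros [|l] hl x hx; simpl.
    - exists (y 0%nat x). exact (hY0 x hx).
    - apply hy; [lia|exact hx]. }
  assert (hwstep : forall l, (l < S n)%nat -> forall x, J x ->
            L_k f l (w l) x = w (S l) x).
  { intros [|l] hl x hx; simpl.
    - unfold L_k, D_minus. rewrite (is_derive_unique _ _ _ (hY0 x hx)). simpl. ring.
    - apply hstep; [lia|exact hx]. }
  assert (e1 : forall l, (l <= S n)%nat -> forall x, J x ->
            opprod (L_k f) 0 l Y0 x = w l x).
  { apply opprod_eq; auto. intros k. apply local_L_k, hJo. }
  assert (e2 : forall l, (l <= S n)%nat -> forall x, J x ->
            opprod (fun _ => inv_D f) 0 l Y0 x = w l x / f x ^ l).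
  { apply (opprod_eq J (fun _ => inv_D f) 0 (S n) (fun l x => w l x / f x ^ l)).
    - intros k. apply local_inv_D, hJo.
    - intros x hx. simpl. field.
    - intros l hl x hx. rewrite <- (hwstep l hl x hx). unfold inv_D.
      replace (Derive (fun t => w l t / f t ^ l) x)
        with (L_k f l (w l) x / f x ^ l).
      + simpl. field. split; [apply pow_nonzero|]; auto.
      + symmetry. apply is_derive_unique, is_derive_div_pow; auto.
        apply hw; [lia|exact hx]. }
  split; [|split].
  - apply (opprod_defined J _ _ _ w); auto; intros l hl; [apply e1|apply hw]; lia.
  - apply (opprod_defined J _ _ _ (fun l x => w l x / f x ^ l)); auto.
    + intros l hl. apply e2. lia.
    + intros l hl x hx. eexists. apply is_derive_div_pow; auto.
      apply hw; [lia|exact hx].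
  - intros x hx. unfold oppow. rewrite e1, e2 by (lia || exact hx).
    split; [reflexivity|]. change (w (S n) x) with (y n x).
    field. apply (pow_nonzero (f x) (S n)). auto.
Qed.

(** * Representation of the solutions *)

Theorem theorem3 (n : nat) (I J : R -> Prop)
    (a yt : nat -> R -> R) (lam : nat -> R)
    (hn : (1 <= n)%nat)
    (hI : is_interval I) (ha0 : continuous_on I (a 0%nat))
    (hJI : forall x, J x -> I x) (hJ : is_interval J) (hJo : open J)
    (hseq : EID_sequence J n a yt lam)
    (hform : forall s, (s <= n)%nat -> forall x, J x ->
       a s x = nth_potential (a 0%nat) (yt 0%nat) s x)
    (hconst : no_integration_constant J n yt) :
  (forall y : nat -> R -> R,
     solves J (a 0%nat) (y 0%nat) ->
     EID_transforms J n yt y ->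
     solves J (nth_potential (a 0%nat) (yt 0%nat) n) (y n) /\
     representation1 J n (yt 0%nat) (y 0%nat) (y n) /\
     (exists Y0, antiderivative_on J (y 0%nat) Y0) /\
     (forall Y0, antiderivative_on J (y 0%nat) Y0 ->
        representation2 J n (yt 0%nat) Y0 (y n)))
  /\
  ((forall s, (s < n)%nat -> lam s <> 0) ->
   forall u : R -> R,
     solves J (nth_potential (a 0%nat) (yt 0%nat) n) u ->
     exists y0 : R -> R,
       solves J (a 0%nat) y0 /\
       representation1 J n (yt 0%nat) y0 u /\
       (exists Y0, antiderivative_on J y0 Y0) /\
       (forall Y0, antiderivative_on J y0 Y0 ->
          representation2 J n (yt 0%nat) Y0 u)).
Proof.
  assert (hmain : forall y : nat -> R -> R,
     solves J (a 0%nat) (y 0%nat) ->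
     EID_transforms J n yt y ->
     solves J (nth_potential (a 0%nat) (yt 0%nat) n) (y n) /\
     representation1 J n (yt 0%nat) (y 0%nat) (y n) /\
     (exists Y0, antiderivative_on J (y 0%nat) Y0) /\
     (forall Y0, antiderivative_on J (y 0%nat) Y0 ->
        representation2 J n (yt 0%nat) Y0 (y n))).
  { intros y hy0 hy.
    pose proof (EID_solves J n a yt y lam hJo hseq hy hy0) as hsol.
    assert (hf : forall x, J x -> ex_derive (yt 0%nat) x).
    { intros x hx. apply (EID_eigenfunction _ _ _ _ _ hseq 0%nat hn x hx). }
    assert (hnz : forall x, J x -> yt 0%nat x <> 0).
    { exact (EID_nonvanishing _ _ _ _ _ hseq 0%nat hn). }
    assert (hd : forall l, (l <= n)%nat -> forall x, J x -> ex_derive (y l) x).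
    { intros l hl x hx. apply (hsol l hl x hx). }
    assert (hstep : forall l, (l < n)%nat -> forall x, J x ->
              L_k (yt 0%nat) (S l) (y l) x = y (S l) x).
    { intros l hl x hx. rewrite (hy l hl x hx).
      rewrite (logder_eigenfunction J n l a yt lam x); auto. }
    split; [|split; [|split]].
    - apply (solves_ext J (a n)); [|apply hsol; lia].
      intros x hx. symmetry. apply hform; [lia|exact hx].
    - apply representation1_of_steps; auto.
    (* [hconst] supplies a point of [J], the lower limit of integration. *)
    - destruct (hconst 0%nat hn) as (c & hc & _).
      apply (ex_antiderivative_on J (y 0%nat) c); auto.
      intros x hx. apply (@ex_derive_continuous R_AbsRing R_NormedModule).
      apply hd; [lia|exact hx].
    - intros Y0. apply representation2_of_steps; auto. }
  split; [exact hmain|].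
  intros hlam u hu.
  destruct (EID_onto J n a yt lam hJo hseq hlam n u) as (y & hy0 & hy & <-).
  - lia.
  - apply (solves_ext J (nth_potential (a 0%nat) (yt 0%nat) n)); [|exact hu].
    intros x hx. apply hform; [lia|exact hx].
  - exists (y 0%nat). split; [exact hy0|]. apply (hmain y hy0 hy).
Qed.
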